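(* Let $\mathcal{X}:=\{1,2,3,4\}$ with $\sigma$-algebra $2^{\mathcal{X}}$, let $\mu$ be the counting measure on $\mathcal{X}$, and for $\theta\in(0,1)$ let $P_\theta$ be the probability measure on $2^{\mathcal{X}}$ with $P_\theta(\{1\})=\theta/3$, $P_\theta(\{2\})=2\theta/3$, $P_\theta(\{3\})=(1-\theta)/3$, $P_\theta(\{4\})=2(1-\theta)/3$; let $p_\theta:\mathcal{X}\to\mathbb{R}$, $p_\theta(i):=P_\theta(\{i\})$, which is a density of $P_\theta$ with respect to $\mu$. Let $U:\mathcal{X}\to\mathcal{X}$ be the identity, $\tilde h:\mathcal{X}\to\mathbb{R}$ the constant function $1$, $\tilde g_\theta:=p_\theta$ for $\theta\in(0,1)$, and $\Theta_0:=(0,1)\cap\mathbb{Q}$. Then: (1) $(\mathcal{X},2^{\mathcal{X}})$ is a standard Borel space (in particular countably generated), $\mu$ is $\sigma$-finite, $P_\theta\ll\mu$ for every $\theta\in(0,1)$, $U$ is measurable, $\tilde h$ and every $\tilde g_\theta$ are non-negative and measurable, and $p_\theta=\tilde g_\theta(U)\,\tilde h$ for every $\theta\in(0,1)$; (2) $\Theta_0$ is a non-empty countable subset of $(0,1)$ and, for any $t_1,t_2\in\mathcal{X}$ satisfying $\tilde g_\theta(t_1)=\tilde g_\theta(t_2)$ for every $\theta\in\Theta_0$, we have $t_1=t_2$; (3) the statistic $T:=\mathbf{1}_{\{1,2\}}:\mathcal{X}\to\{0,1\}$ is sufficient for $(\mathcal{X},2^{\mathcal{X}},\{P_\theta\}_{\theta\in(0,1)})$;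 (4) $U$ is not minimal sufficient for $(\mathcal{X},2^{\mathcal{X}},\{P_\theta\}_{\theta\in(0,1)})$.
   Context: A statistical model is a triple $(\mathcal{X},\Sigma,\{P_\theta\}_{\theta\in\Theta})$ with $(\mathcal{X},\Sigma)$ a measurable space, $\Theta$ a non-empty set and each $P_\theta$ a probability measure on $(\mathcal{X},\Sigma)$. A statistic is a measurable function $T:\mathcal{X}\to\mathcal{T}$ into a measurable space $(\mathcal{T},\Sigma_{\mathcal{T}})$. $T$ is sufficient iff for each $E\in\Sigma$ there is a measurable $\kappa_E:\mathcal{T}\to\mathbb{R}$ such that for every $\theta\in\Theta$, $P_\theta(E\mid T)=\kappa_E(T)$ $P_\theta$-a.e. (where $P_\theta(E\mid T)$ is the conditional probability given $\sigma(T)$). $T$ is minimal sufficient iff it is sufficient and, for every measurable space $(\mathcal{S},\Sigma_{\mathcal{S}})$ and every sufficient statistic $S:\mathcal{X}\to\mathcal{S}$, there is a measurable $f:\mathcal{S}\to\mathcal{T}$ such that for each $\theta\in\Theta$, $T=f(S)$ $P_\theta$-a.e. A standard Borel space is a measurable space whose $\sigma$-algebra is the Borel $\sigma$-algebra of a complete separable metric space. A measurable space is countably generated iff its $\sigma$-algebra is generated by a countable collection of measurable sets. The set $\{0,1\}$ carries the $\sigma$-algebra of all its subsets. *)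

(* Defs.v *)
From HB Require Import structures.
From mathcomp Require Import all_boot all_order all_algebra.
From mathcomp Require Import all_classical all_reals all_analysis.
From mathcomp Require Import lra.

Set Implicit Arguments.
Unset Strict Implicit.
Unset Printing Implicit Defensive.
Import Order.TTheory GRing.Theory Num.Theory.
Import numFieldNormedType.Exports.
Local Open Scope classical_set_scope.
Local Open Scope ring_scope.

Definition countably_generated d (T : measurableType d) : Prop :=
  exists2 G : set (set T), countable G & @measurable d T = <<s G >>.

(* The metric is a [metricType] structure put on the carrier of [T] itself. *)
Definition standard_borel (R : realType) d (T : measurableType d) : Prop :=
  exists c : Metric.axioms_ R T, let M : metricType R := Metric.Pack c in
  [/\ forall u : nat -> M, cauchy (u @ \oo) -> exists l : M, u @ \oo --> l,
      exists2 D : set M, countable D & dense D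
    & @measurable d T = <<s [set A : set M | open A] >>].

Definition sigma_of d (X : measurableType d) d' (Y : measurableType d')
    (T : X -> Y) : set (set X) :=
  preimage_set_system setT T measurable.

(* [f] is a version of the conditional probability P(E | T). *)
Definition cond_prob_version (R : realType) d (X : measurableType d)
    d' (Y : measurableType d') (P : probability X R) (T : X -> Y)
    (E : set X) (f : X -> R) : Prop :=
  [/\ forall B : set R, measurable B -> sigma_of T (f @^-1` B),
      P.-integrable setT (EFin \o f)
    & forall A, sigma_of T A ->
        (\int[P]_(x in A) (f x)%:E)%E = P (E `&` A)].

Definition sufficient (R : realType) d (X : measurableType d)
    (Theta : Type) (P : Theta -> probability X R)
    d' (Y : measurableType d') (T : X -> Y) : Prop :=
  measurable_fun setT T /\
  forall E : set X, measurable E ->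
    exists2 kappa : Y -> R, measurable_fun setT kappa &
      forall theta, exists2 f : X -> R, cond_prob_version (P theta) T E f &
        {ae P theta, forall x, f x = kappa (T x)}.

Definition minimal_sufficient (R : realType) d (X : measurableType d)
    (Theta : Type) (P : Theta -> probability X R)
    d' (Y : measurableType d') (T : X -> Y) : Prop :=
  sufficient P T /\
  forall (dS : measure_display) (S : measurableType dS) (s : X -> S),
    sufficient P s ->
    exists2 f : S -> Y, measurable_fun setT f &
      forall theta, {ae P theta, forall x, T x = f (s x)}.

(* The sample space {1,2,3,4}: the point k is the ordinal k - 1. *)
Definition four_points : Type := 'I_4.

HB.instance Definition _ := Choice.on four_points.
HB.instance Definition _ := isPointed.Build four_points (ord0 : 'I_4).
HB.instance Definition _ := @isMeasurable.Build default_measure_display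
  four_points discrete_measurable discrete_measurable0
  discrete_measurableC discrete_measurableU.

Definition x1 : four_points := @Ordinal 4 0 isT.
Definition x2 : four_points := @Ordinal 4 1 isT.
Definition x3 : four_points := @Ordinal 4 2 isT.
Definition x4 : four_points := @Ordinal 4 3 isT.

Definition param (R : realType) : Type := {theta : R | 0 < theta < 1}.

Section model.
Context (R : realType).
Implicit Type theta : param R.

Definition weight theta : seq R :=
  let t := sval theta in
  [:: t / 3; 2 * t / 3; (1 - t) / 3; 2 * (1 - t) / 3].

Lemma weight_ge0 theta (k : nat) : 0 <= (weight theta)`_k.
Proof.
have /andP[t0 t1] := svalP theta.
by case: k => [|[|[|[|k]]]]; rewrite /weight /= ?nth_nil//; lra.
Qed.

(* The discrete measure with mass [(weight theta)`_k] at the point k + 1. *)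
Definition model theta : set four_points -> \bar R :=
  msum (fun k : nat => mscale (NngNum (weight_ge0 theta k))
                              \d_(inord k : four_points)) 4.

HB.instance Definition _ theta := Measure.on (model theta).

Let model_setT theta : model theta setT = 1%E.
Proof.
rewrite /model /msum !big_ord_recr big_ord0 /= /mscale /= !diracT !mule1.
rewrite add0e -!EFinD; congr EFin; lra.
Qed.

HB.instance Definition _ theta :=
  Measure_isProbability.Build _ _ _ (model theta) (model_setT theta).

End model.

(* Main.v *)
Require Import Defs.
From HB Require Import structures.
From mathcomp Require Import all_boot all_order all_algebra.
From mathcomp Require Import all_classical all_reals all_analysis.
From mathcomp Require Import ring lra.
Import Order.TTheory GRing.Theory Num.Theory.
Import numFieldNormedType.Exports.
Local Open Scope classical_set_scope.
Local Open Scope ring_scope.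

(** The point masses at 1 and 2 are proportional, in the ratio 1 : 2 for every
    parameter, and so are those at 3 and 4. Hence, given that the observation
    lies in {1,2} or that it lies in {3,4}, its conditional law is (1/3, 2/3) on
    that pair and is free of the parameter: the indicator of {1,2} is
    sufficient, with [pair_kernel] as common conditional probability. The
    identity is not minimal sufficient, for it would have to be a function of
    this indicator almost surely; every point has positive mass
    ([weight_gt0]), so the relation would hold everywhere ([model_ae]), although
    the indicator merges 1 and 2. On the other hand the identity satisfies
    every regularity condition and its densities separate points: already at
    the rational parameter 1/4 the four masses 1/12, 2/12, 3/12, 6/12 are
    distinct ([weight_quarter_inj]).

    All integrals reduce to finite sums over the four points
    ([integral_four_points]). That the sample space is standard Borel is an
    instance of [discrete_standard_borel]: a countable space in which all sets
    are measurable is the Borel space of its 0-1 metric. *)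

(** * Countable discrete spaces are standard Borel *)

(** A copy of [T] indexed by [R], so that instance resolution can read the field
    of values of the metric off the type. *)
Definition discrete_metric (R : realType) (T : choiceType) : Type := T.

Section discrete_metric.
Context (R : realType) (T : choiceType).
Implicit Types x y z : discrete_metric R T.

HB.instance Definition _ := Choice.on (discrete_metric R T).

Definition discrete_dist x y : R := (x != y)%:R.

Lemma discrete_distxx x : discrete_dist x x = 0.
Proof. by rewrite /discrete_dist eqxx. Qed.

Lemma discrete_dist_eq0 x y : discrete_dist x y = 0 -> x = y.
Proof.
by rewrite /discrete_dist; case: eqVneq => //= _ /eqP; rewrite oner_eq0.
Qed.

Lemma discrete_dist_sym x y : discrete_dist x y = discrete_dist y x.
Proof. by rewrite /discrete_dist eq_sym. Qed.

Lemma discrete_dist_triangle y x z :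
  discrete_dist x z <= discrete_dist x y + discrete_dist y z.
Proof.
rewrite /discrete_dist -natrD ler_nat.
case: (eqVneq x y) => [->|_]; first by rewrite add0n.
exact: leq_trans (leq_b1 _) (leq_addr _ _).
Qed.

HB.instance Definition _ := @isMetric.Build R (discrete_metric R T)
  discrete_dist discrete_distxx discrete_dist_eq0 discrete_dist_sym
  discrete_dist_triangle.

Lemma discrete_metric_ball x : ball x (1 : R) = [set x].
Proof.
rewrite ballEmdist; apply/seteqP; split => y /=; last first.
  by move=> ->; rewrite mdistxx.
have -> : mdist x y = discrete_dist x y by [].
by rewrite /discrete_dist; case: eqVneq => //=; rewrite ltxx.
Qed.

Lemma discrete_metric_open (A : set (discrete_metric R T)) : open A.
Proof.
rewrite openE => x Ax; apply/nbhs_ballP; exists 1 => //=.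
by rewrite discrete_metric_ball => y ->.
Qed.

(** A Cauchy sequence eventually stays in one ball of radius 1, hence is
    eventually constant. *)
Lemma discrete_metric_complete (u : nat -> discrete_metric R T) :
  cauchy (u @ \oo) -> exists l : discrete_metric R T, u @ \oo --> l.
Proof.
move=> /cauchyP uC.
have [l ul] := uC (1 : R) ltr01; exists l.
move: ul; rewrite discrete_metric_ball => ul A lA.
apply: filterS ul => x ->; exact: (@nbhs_singleton (discrete_metric R T) l).
Qed.

End discrete_metric.

Lemma discrete_standard_borel (R : realType) d (T : measurableType d) :
  countable [set: T] -> (forall A : set T, measurable A) ->
  standard_borel R T.
Proof.
move=> cT mT; exists (Metric.class (discrete_metric R T)); split.
- exact: discrete_metric_complete.
- by exists setT => // O [x Ox] _; exists x.
- apply/seteqP; split => A _; last exact: mT.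
  by apply: sub_sigma_algebra; exact: discrete_metric_open.
Qed.

Lemma discrete_countably_generated d (T : measurableType d) :
  countable [set: T] -> (forall A : set T, measurable A) ->
  countably_generated T.
Proof.
move=> cT mT; exists (range (@set1 T)).
  exact: sub_countable (card_image_le _ _) cT.
apply/seteqP; split => A _; last exact: mT.
pose G := range (@set1 T).
have -> : A = \bigcup_x (if x \in A then [set x] else set0).
  by rewrite -bigcup_mkcond bigcup_imset1 image_id.
apply: (@countable_bigcupT_measurable _ (g_sigma_algebraType G)) => // x.
case: ifP => _; last exact: measurable0.
by apply: sub_sigma_algebra; exists x.
Qed.

(** * Sums and integrals over the four points *)

Lemma countable_four_points : countable [set: four_points].
Proof. exact: (countableP [set: 'I_4]). Qed.

Lemma sigma_finite_counting_four_points (R : realType) :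
  sigma_finite [set: four_points] (@counting four_points R).
Proof.
exists (fun=> setT); first by rewrite bigcup_const//; exists 0%N.
move=> _; split=> //; rewrite /counting asboolT ?ltry//.
exact: (@finite_finset 'I_4).
Qed.

(** [A] is the disjoint union of its singletons, on each of which [f] is
    constant. *)
Lemma integral_four_points (R : realType)
    (nu : {measure set four_points -> \bar R})
    (A : set four_points) (f : four_points -> R) : (forall x, 0 <= f x) ->
  (\int[nu]_(x in A) (f x)%:E =
   \sum_(i < 4 | (i : four_points) \in A) (f i)%:E * nu [set i])%E.
Proof.
move=> f0.
pose s := [seq i : four_points <- enum 'I_4 | i \in A].
have us : uniq s by rewrite filter_uniq ?enum_uniq.
have sA : A = \big[setU/set0]_(i <- s) [set i].
  rewrite -bigcup_seq bigcup_imset1 image_id; apply/seteqP; split => x /=.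
    by move=> Ax; rewrite mem_filter mem_set//= mem_enum.
  by rewrite mem_filter => /andP[/set_mem].
rewrite [in LHS]sA ge0_integral_bigsetU//.
- rewrite big_filter big_enum_cond/=; apply: eq_bigr => i _.
  rewrite -integral_cst//; apply: eq_integral => x.
  by rewrite inE => ->.
- apply/trivIsetP => i j _ _ ij; apply/seteqP; split => x // [->] /eqP.
  by rewrite (negbTE ij).
- by move=> x _; rewrite lee_fin.
Qed.

Lemma four_points_case (Q : four_points -> Prop) :
  Q x1 -> Q x2 -> Q x3 -> Q x4 -> forall x, Q x.
Proof.
move=> Q1 Q2 Q3 Q4 [[|[|[|[|//]]]] x_lt4].
- by rewrite (_ : Ordinal _ = x1)//; exact: val_inj.
- by rewrite (_ : Ordinal _ = x2)//; exact: val_inj.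
- by rewrite (_ : Ordinal _ = x3)//; exact: val_inj.
- by rewrite (_ : Ordinal _ = x4)//; exact: val_inj.
Qed.

Lemma sum_four_points (V : nmodType) (F : four_points -> V) :
  \sum_(i < 4) F i = F x1 + F x2 + F x3 + F x4.
Proof.
rewrite !big_ord_recr big_ord0 /= add0r.
by congr (F _ + F _ + F _ + F _); exact: val_inj.
Qed.

(** * The model *)

Section model_facts.
Context {R : realType}.
Implicit Type theta : param R.

Lemma modelE theta A :
  model theta A =
  (\sum_(i < 4) (weight theta)`_i * ((i : four_points) \in A)%:R)%:E.
Proof.
rewrite /model /msum -sumEFin; apply: eq_bigr => i _.
by rewrite /mscale inord_val EFinM -diracE.
Qed.

Lemma model1 theta (i : four_points) :
  model theta [set i] = ((weight theta)`_i)%:E.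
Proof.
rewrite modelE (bigD1 (i : 'I_4))//= mem_set// mulr1 big1 ?addr0// => j ji.
by rewrite memNset ?mulr0//= => /eqP; rewrite (negbTE ji).
Qed.

Lemma weight_gt0 theta (i : four_points) : 0 < (weight theta)`_i.
Proof.
have /andP[t0 t1] := svalP theta.
by elim/four_points_case: i; rewrite /weight/=; lra.
Qed.

(** No point lies in a null set, since all four masses are positive. *)
Lemma model_ae theta (Q : four_points -> Prop) :
  {ae model theta, forall x, Q x} -> forall x, Q x.
Proof.
move=> [N [mN N0 QN]] x; apply: contrapT => nQx.
have : (model theta [set x] <= model theta N)%E.
  by apply: le_measure; rewrite ?inE// => y ->; exact: QN.
by rewrite N0 model1 lee_fin leNgt weight_gt0.
Qed.

Lemma model_density theta (A : set four_points) :
  model theta A =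
  (\int[@counting four_points R]_(x in A) (fine (model theta [set x]))%:E)%E.
Proof.
rewrite integral_four_points => [|x]; last by rewrite fine_ge0.
rewrite modelE -sumEFin [RHS]big_mkcond/=; apply: eq_bigr => i _.
rewrite model1 /= /counting asboolT// fset_set1 finmap.cardfs1.
by case: ifP; rewrite ?mulr0// mulr1 mule1.
Qed.

(** * Sufficiency of the indicator of the first pair *)

Definition first_pair (x : four_points) : bool := x \in [set x1; x2].

Lemma first_pairE :
  (first_pair x1 = true) * (first_pair x2 = true) *
  (first_pair x3 = false) * (first_pair x4 = false).
Proof.
split; [split; [split|]|].
- by apply/mem_set; left.
- by apply/mem_set; right.
- by apply/memNset => -[].
- by apply/memNset => -[].
Qed.

(** The conditional probability of [E] given the pair: the masses within either
    pair are in the ratio 1 : 2. *)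
Definition pair_kernel (E : set four_points) (b : bool) : R :=
  if b then ((x1 \in E)%:R + 2 * (x2 \in E)%:R) / 3
  else ((x3 \in E)%:R + 2 * (x4 \in E)%:R) / 3.

Lemma pair_kernel_ge0 E b : 0 <= pair_kernel E b.
Proof.
by case: b; rewrite divr_ge0// addr_ge0// mulr_ge0.
Qed.

(** The defining integral identity need only be checked on the preimages of the
    four subsets of [bool], where it is an identity between sums of at most four
    terms. *)
Lemma pair_kernel_cond_prob theta (E : set four_points) :
  cond_prob_version (model theta) first_pair E (pair_kernel E \o first_pair).
Proof.
split=> [B _||_ [C _ <-]].
- by exists (pair_kernel E @^-1` B) => //; rewrite setTI.
- apply: measurable_bounded_integrable => //.
    exact: le_lt_trans (probability_le1 _ _) (ltry 1).
  (* Being a conditional probability, the kernel is bounded by 1. *)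
  exists 1; split=> // M M1 x _ /=.
  rewrite ger0_norm ?pair_kernel_ge0// (le_trans _ (ltW M1))//.
  rewrite /pair_kernel; case: first_pair.
    by case: (x1 \in E); case: (x2 \in E) => /=; lra.
  by case: (x3 \in E); case: (x4 \in E) => /=; lra.
- rewrite integral_four_points => [|x]; last exact: pair_kernel_ge0.
  under eq_bigr do rewrite [X in (_ * X)%E]model1 -EFinM.
  rewrite sumEFin [RHS]modelE; congr EFin; rewrite big_mkcond/=.
  have inC x : (x \in [set: four_points] `&` first_pair @^-1` C) =
               (first_pair x \in C).
    by apply/idP/idP => /set_mem => [[_ Cx]|Cx]; exact/mem_set.
  under eq_bigr do rewrite inC.
  under [RHS]eq_bigr do rewrite in_setI inC.
  rewrite !sum_four_points !first_pairE /pair_kernel /weight/=.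
  by case: (true \in C); case: (false \in C); rewrite ?andbF ?andbT /=;
    move: (sval theta) ((x1 \in E)%:R : R) ((x2 \in E)%:R : R)
      ((x3 \in E)%:R : R) ((x4 \in E)%:R : R) => t e1 e2 e3 e4;
    rewrite ?mulr0n; field.
Qed.

Lemma first_pair_sufficient :
  sufficient (fun theta : param R => model theta : probability _ R) first_pair.
Proof.
split=> // E _; exists (pair_kernel E) => // theta.
exists (pair_kernel E \o first_pair); first exact: pair_kernel_cond_prob.
exact: aeW.
Qed.

(** * Separation of points and failure of minimality *)

Fact quarter_in01 : 0 < (4^-1 : R) < 1.
Proof. by apply/andP; split; lra. Qed.

Definition quarter : param R := exist _ 4^-1 quarter_in01.

Lemma weight_quarter_inj (i j : four_points) :
  (weight quarter)`_i = (weight quarter)`_j -> i = j.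
Proof.
by elim/four_points_case: i; elim/four_points_case: j => //;
  rewrite /weight/= => H; exfalso; lra.
Qed.

(** Minimality would make the identity factor through [first_pair], which does
    not distinguish 1 from 2. *)
Lemma id_not_minimal_sufficient :
  ~ minimal_sufficient (fun theta : param R => model theta : probability _ R)
      (fun x : four_points => x).
Proof.
move=> [_ /(_ _ _ _ first_pair_sufficient) [f _ /(_ quarter) /model_ae fT]].
have x12 : x1 = x2 by rewrite (fT x1) (fT x2) !first_pairE.
by move/(congr1 val): x12.
Qed.

End model_facts.

Theorem mainTheorem2 (R : realType) :
  let P : param R -> probability four_points R := fun theta => model theta in
  let mu : {measure set four_points -> \bar R} := counting in
  let p : param R -> four_points -> R := 
    fun theta i => fine (P theta [set i]) in
  let U : four_points -> four_points := fun x => x in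
  let h : four_points -> R := fun=> 1 in
  let g : param R -> four_points -> R := p in
  let Theta0 : set R := [set t | 0 < t < 1] `&` range (@ratr R) in
  let T : four_points -> bool := fun x => x \in [set x1; x2] in
  (forall theta : param R,
     [/\ P theta [set x1] = (sval theta / 3)%:E,
         P theta [set x2] = (2 * sval theta / 3)%:E,
         P theta [set x3] = ((1 - sval theta) / 3)%:E &
         P theta [set x4] = (2 * (1 - sval theta) / 3)%:E] /\
     (forall A : set four_points, measurable A ->
        P theta A = (\int[mu]_(x in A) (p theta x)%:E)%E)) /\
  (* (1) *)
  (standard_borel R four_points /\ countably_generated four_points /\
   sigma_finite setT mu /\ (forall theta, P theta `<< mu) /\
   measurable_fun setT U /\
   (measurable_fun setT h /\ (forall x, 0 <= h x)) /\
   (forall theta, measurable_fun setT (g theta) /\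
                  (forall x, 0 <= g theta x)) /\
   (forall theta x, p theta x = g theta (U x) * h x)) /\
  (* (2) *)
  (Theta0 !=set0 /\ countable (Theta0) /\
   Theta0 `<=` [set t | 0 < t < 1] /\
   (forall t1 t2 : four_points,
      (forall theta : param R, Theta0 (sval theta) ->
         g theta t1 = g theta t2) ->
      t1 = t2)) /\
  (* (3) *)
  sufficient P T /\
  (* (4) *)
  ~ minimal_sufficient P U.
Proof.
move=> P mu p U h g Theta0 T.
have pE theta x : p theta x = (weight theta)`_x
  by rewrite /p [X in fine X]model1.
split; [|split; [|split; [|split]]].
- move=> theta; split; last by move=> A _; exact: model_density.
  by split; exact: model1.
- split; [|split; [|split; [|split; [|split; [|split; [|split]]]]]] => //.
  + exact: discrete_standard_borel countable_four_points _.
  + exact: discrete_countably_generated countable_four_points _.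
  + exact: sigma_finite_counting_four_points.
  + move=> theta A muA0 B mB BA.
    rewrite [LHS]model_density null_set_integral//; exact: muA0.
  + by move=> theta; split => // x; rewrite fine_ge0.
  + by move=> theta x; rewrite mulr1.
- have Theta0_quarter : Theta0 (sval (@quarter R)).
    split; first exact: quarter_in01.
    by exists 4^-1 => //; rewrite fmorphV rmorph_nat.
  split; [by exists (sval (@quarter R))|split; [|split]].
  + apply: sub_countable (subset_card_le _) _; first exact: subIsetr.
    exact: sub_countable (card_image_le _ _) (countableP _).
  + exact: subIsetl.
  + move=> t1 t2 /(_ _ Theta0_quarter); rewrite /g !pE.
    exact: weight_quarter_inj.
- exact: first_pair_sufficient.
- exact: id_not_minimal_sufficient.
Qed.
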